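(* Let $\lambda\in\mathbb{K}$, let $(A,\mathcal{I})$ be a $\lambda$-weighted Rota-Baxter Jacobi-Jordan algebra and let $(V,\mathcal{T})$ (with action $\rho$) be a representation of $(A,\mathcal{I})$. Define $\tilde\rho:A\to gl(V)$ by $\tilde\rho(x)u:=\rho(\mathcal{I}x)u-\mathcal{T}(\rho(x)u)$ for all $x\in A$, $u\in V$. Then $\tilde\rho$ defines a representation of the Jacobi-Jordan algebra $A_{\mathcal{I}}$ on $V$. Moreover, $(\tilde V=(V,\tilde\rho),\mathcal{T})$ is a representation of the $\lambda$-weighted Rota-Baxter Jacobi-Jordan algebra $(A_{\mathcal{I}},\mathcal{I})$.
   Context: $\mathbb{K}$ is a field of characteristic $0$; all vector spaces and linear maps are over $\mathbb{K}$; $gl(V)$ denotes the space of linear endomorphisms of $V$. A Jacobi-Jordan algebra is a vector space $A$ with a bilinear product $\ast$ such that $x\ast y=y\ast x$ and $(x\ast y)\ast z+(y\ast z)\ast x+(z\ast x)\ast y=0$ for all $x,y,z\in A$. A $\lambda$-weighted Rota-Baxter operator on $(A,\ast)$ is a linear map $\mathcal{I}:A\to A$ with $\mathcal{I}(x)\ast\mathcal{I}(y)=\mathcal{I}(\mathcal{I}(x)\ast y+x\ast\mathcal{I}(y)+\lambda(x\ast y))$ for all $x,y\in A$; then $(A,\mathcal{I})$ is called a $\lambda$-weighted Rota-Baxter Jacobi-Jordan algebra. A representation of a Jacobi-Jordan algebra $A$ is a vector space $V$ with a linear map $\rho:A\to gl(V)$ such that $\rho(x\ast y)=-\rho(x)\rho(y)-\rho(y)\rho(x)$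 for all $x,y\in A$. A representation of $(A,\mathcal{I})$ is a triple $(V,\rho,\mathcal{T})$, written $(V,\mathcal{T})$, where $(V,\rho)$ is a representation of the Jacobi-Jordan algebra $A$ and $\mathcal{T}:V\to V$ is linear with $\rho(\mathcal{I}x)(\mathcal{T}u)=\mathcal{T}(\rho(\mathcal{I}x)u+\rho(x)(\mathcal{T}u)+\lambda\rho(x)u)$ for all $x\in A$, $u\in V$. $A_{\mathcal{I}}$ denotes the vector space $A$ with the product $x\ast_{\mathcal{I}}y:=\mathcal{I}(x)\ast y+x\ast\mathcal{I}(y)+\lambda(x\ast y)$; it is a Jacobi-Jordan algebra and $(A_{\mathcal{I}},\mathcal{I})$ is a $\lambda$-weighted Rota-Baxter Jacobi-Jordan algebra. *)

(* Defs.v *)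
(* Vector spaces are lmodTypes over a field, of arbitrary
   (possibly infinite) dimension. *)
From HB Require Import structures.
From mathcomp Require Import all_boot all_order all_algebra.

Set Implicit Arguments.
Unset Strict Implicit.
Unset Printing Implicit Defensive.

Import GRing.Theory.
Local Open Scope ring_scope.

Record jjAlgebra (K : fieldType) := JJAlgebra {
  jj_sort :> lmodType K;
  jj_mul : {bilinear jj_sort -> jj_sort -> jj_sort};
  jj_mulC : forall x y : jj_sort, jj_mul x y = jj_mul y x;
  jj_jacobi : forall x y z : jj_sort,
    jj_mul (jj_mul x y) z + jj_mul (jj_mul y z) x + jj_mul (jj_mul z x) y = 0
}.

Definition rota_baxter (K : fieldType) (lambda : K) (A : jjAlgebra K)
    (I : {linear A -> A}) : Prop :=
  forall x y : A,
    jj_mul A (I x) (I y) =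
    I (jj_mul A (I x) y + jj_mul A x (I y) + lambda *: jj_mul A x y).

Record rbjjAlgebra (K : fieldType) (lambda : K) := RBJJAlgebra {
  rb_alg :> jjAlgebra K;
  rb_op : {linear rb_alg -> rb_alg};
  rb_opP : rota_baxter lambda rb_op
}.

(* gl(V) is {linear V -> V}.  MathComp puts no lmodType structure on this type,
   so linearity of rho : A -> gl(V) and the representation identity, which are
   equations in gl(V), are stated pointwise on V. *)
Definition jj_representation (K : fieldType) (A : jjAlgebra K) (V : lmodType K)
    (rho : A -> {linear V -> V}) : Prop :=
  (forall (a : K) (x y : A) (u : V),
      rho (a *: x + y) u = a *: rho x u + rho y u) /\
  (forall (x y : A) (u : V),
      rho (jj_mul A x y) u = - rho x (rho y u) - rho y (rho x u)).

Definition rbjj_representation (K : fieldType) (lambda : K)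
    (A : rbjjAlgebra lambda) (V : lmodType K)
    (rho : A -> {linear V -> V}) (T : {linear V -> V}) : Prop :=
  jj_representation rho /\
  (forall (x : A) (u : V),
      rho (rb_op A x) (T u) =
      T (rho (rb_op A x) u + rho x (T u) + lambda *: rho x u)).

Definition rb_mul (K : fieldType) (lambda : K) (A : rbjjAlgebra lambda)
    (x y : A) : A :=
  jj_mul A (rb_op A x) y + jj_mul A x (rb_op A y) + lambda *: jj_mul A x y.

Lemma rb_mul_bilinear (K : fieldType) (lambda : K) (A : rbjjAlgebra lambda) :
  bilinear_for *:%R *:%R (@rb_mul K lambda A).
Proof.
by split=> z a x y; rewrite /rb_mul !(linearP, linearPl, linearPr) /= !scalerDr
  !addrA [LHS](ACl (1*3*5*2*4*6)%AC).
Qed.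

HB.instance Definition _ (K : fieldType) (lambda : K)
    (A : rbjjAlgebra lambda) :=
  bilinear_isBilinear.Build K A A A *:%R *:%R (@rb_mul K lambda A)
    (rb_mul_bilinear A).

Lemma rb_mulC (K : fieldType) (lambda : K) (A : rbjjAlgebra lambda)
    (x y : A) : rb_mul x y = rb_mul y x.
Proof.
by rewrite /rb_mul (jj_mulC (rb_op A x) y) (jj_mulC x (rb_op A y)) (jj_mulC x y)
  (addrC (jj_mul A y _)).
Qed.

Lemma rb_mul_jacobi (K : fieldType) (lambda : K) (A : rbjjAlgebra lambda)
    (x y z : A) :
  rb_mul (rb_mul x y) z + rb_mul (rb_mul y z) x + rb_mul (rb_mul z x) y = 0.
Proof.
have E u v w : rb_mul (rb_mul u v) w =
    jj_mul A (jj_mul A (rb_op A u) (rb_op A v)) w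
    + jj_mul A (jj_mul A (rb_op A u) v) (rb_op A w)
    + jj_mul A (jj_mul A u (rb_op A v)) (rb_op A w)
    + lambda *: jj_mul A (jj_mul A u v) (rb_op A w)
    + lambda *: jj_mul A (jj_mul A (rb_op A u) v) w
    + lambda *: jj_mul A (jj_mul A u (rb_op A v)) w
    + lambda *: (lambda *: jj_mul A (jj_mul A u v) w).
  rewrite {1}/rb_mul [in rb_op A (rb_mul u v)]/rb_mul -(@rb_opP _ _ A).
  by rewrite /rb_mul !linearDl !linearZl_LR /= !scalerDr !addrA.
have S (a b c d e f : A) :
    (a + b) + (c + d) + (e + f) = (a + c + e) + (b + d + f).
  by rewrite (addrACA a) [LHS]addrACA.
have {S}S (a1 a2 a3 a4 a5 a6 a7 b1 b2 b3 b4 b5 b6 b7 c1 c2 c3 c4 c5 c6 c7 : A) :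
    a1 + b2 + c3 = 0 -> a2 + b3 + c1 = 0 -> a3 + b1 + c2 = 0 ->
    a4 + b6 + c5 = 0 -> a5 + b4 + c6 = 0 -> a6 + b5 + c4 = 0 ->
    a7 + b7 + c7 = 0 ->
    (a1 + a2 + a3 + a4 + a5 + a6 + a7) + (b1 + b2 + b3 + b4 + b5 + b6 + b7)
    + (c1 + c2 + c3 + c4 + c5 + c6 + c7) = 0.
  move=> h1 h2 h3 h4 h5 h6 h7.
  have -> : b1 + b2 + b3 + b4 + b5 + b6 + b7 = b2 + b3 + b1 + b6 + b4 + b5 + b7.
    by rewrite [LHS](ACl (2*3*1*6*4*5*7)%AC).
  have -> : c1 + c2 + c3 + c4 + c5 + c6 + c7 = c3 + c1 + c2 + c5 + c6 + c4 + c7.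
    by rewrite [LHS](ACl (3*1*2*5*6*4*7)%AC).
  by rewrite (S _ a7) (S _ a6) (S _ a5) (S _ a4) (S _ a3) (S _ a2) h1 h2 h3 h4 h5 h6 h7 !addr0.
rewrite !E; apply: S; rewrite -?scalerDr jj_jacobi ?scaler0 //.
Qed.

Lemma rb_op_mul (K : fieldType) (lambda : K) (A : rbjjAlgebra lambda) (x y : A) :
  rb_mul (rb_op A x) (rb_op A y) =
  rb_op A (rb_mul (rb_op A x) y + rb_mul x (rb_op A y) + lambda *: rb_mul x y).
Proof.
have M u v : rb_op A (rb_mul u v) = jj_mul A (rb_op A u) (rb_op A v).
  by rewrite (@rb_opP _ _ A).
by rewrite 2!linearD linearZ /= !M.
Qed.

Definition rb_jjAlgebra (K : fieldType) (lambda : K) (A : rbjjAlgebra lambda) :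
    jjAlgebra K :=
  @JJAlgebra K A (@rb_mul K lambda A) (@rb_mulC K lambda A)
    (@rb_mul_jacobi K lambda A).

(* (A_I, I): same underlying vector space and operator as A, product rb_mul. *)
Definition rb_derived (K : fieldType) (lambda : K) (A : rbjjAlgebra lambda) :
    rbjjAlgebra lambda :=
  @RBJJAlgebra K lambda (rb_jjAlgebra A) (rb_op A) (@rb_op_mul K lambda A).

Definition rho_tilde (K : fieldType) (lambda : K) (A : rbjjAlgebra lambda)
    (V : lmodType K) (rho : A -> {linear V -> V}) (T : {linear V -> V})
    (x : A) : {linear V -> V} :=
  rho (rb_op A x) \- (T \o rho x).

(* Main.v *)
Require Import Defs.
From mathcomp Require Import all_boot all_order all_algebra.

(** Write [x] for [rho x] and [X] for [rho (I x)], as operators on [V].  The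
    compatibility of [T] with [rho] is [X T = T (X + x T + lambda x)], so that
    [rho~ x = X - T x] satisfies the commutation rule
    [rho~ x T = T (X + lambda x)]: the term [T x T] cancels
    ([rho_tilde_intertwine]).  Both claims follow from this rule.

    It gives [rho~ x rho~ y = X Y - T (X y + x Y + lambda x y)].  The
    Rota-Baxter identity says that [I (x *_I y) = I x * I y], so symmetrizing
    in [x] and [y] and applying the representation identity of [rho] to the
    four products [I x * I y], [I x * y], [x * I y] and [x * y] turns the
    anticommutator into [- rho~ (x *_I y)].

    For the compatibility of [T] with [rho~], the rule at [I x] gives
    [rho~ (I x) T = T (rho (I (I x)) + lambda X)], and the rule at [x] shows
    that [rho~ (I x) + rho~ x T + lambda rho~ x] is that same bracket, since
    the terms with [T] in front, [T X] and [lambda T x], cancel. *)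

Set Implicit Arguments.
Unset Strict Implicit.
Unset Printing Implicit Defensive.

Import GRing.Theory.
Local Open Scope ring_scope.

Lemma jj_representationD (K : fieldType) (A : jjAlgebra K) (V : lmodType K)
    (rho : A -> {linear V -> V}) (hrho : jj_representation rho) (x y : A)
    (u : V) :
  rho (x + y) u = rho x u + rho y u.
Proof. by rewrite -{1}[x]scale1r (proj1 hrho) scale1r. Qed.

Lemma jj_representationZ (K : fieldType) (A : jjAlgebra K) (V : lmodType K)
    (rho : A -> {linear V -> V}) (hrho : jj_representation rho) (a : K) (x : A)
    (u : V) :
  rho (a *: x) u = a *: rho x u.
Proof.
have rho0 : rho 0 u = 0.
  by apply: (addrI (rho 0 u)); rewrite -(jj_representationD hrho) !addr0.
by rewrite -[a *: x]addr0 (proj1 hrho) rho0 addr0.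
Qed.

Lemma rho_tildeE (K : fieldType) (lambda : K) (A : rbjjAlgebra lambda)
    (V : lmodType K) (rho : A -> {linear V -> V}) (T : {linear V -> V})
    (x : A) (u : V) :
  rho_tilde rho T x u = rho (rb_op A x) u - T (rho x u).
Proof. by []. Qed.

Lemma rb_op_rb_mul (K : fieldType) (lambda : K) (A : rbjjAlgebra lambda)
    (x y : A) :
  rb_op A (rb_mul x y) = jj_mul A (rb_op A x) (rb_op A y).
Proof. by rewrite (@rb_opP _ _ A). Qed.

(** Moving [T] to the left of [rho (I x)] creates a term [T (rho x (T u))],
    which is the one that [rho_tilde] subtracts. *)
Lemma rho_tilde_intertwine (K : fieldType) (lambda : K)
    (A : rbjjAlgebra lambda) (V : lmodType K) (rho : A -> {linear V -> V})
    (T : {linear V -> V}) (hV : rbjj_representation rho T) (x : A) (u : V) :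
  rho_tilde rho T x (T u) = T (rho (rb_op A x) u + lambda *: rho x u).
Proof.
by rewrite rho_tildeE (proj2 hV) -linearB /= addrAC addrK.
Qed.

(** The argument of [T] is the shape of [x *_I y] with each product of [A]
    replaced by a composition of actions, which is why the anticommutator is
    governed by the derived product. *)
Lemma rho_tilde_comp (K : fieldType) (lambda : K)
    (A : rbjjAlgebra lambda) (V : lmodType K) (rho : A -> {linear V -> V})
    (T : {linear V -> V}) (hV : rbjj_representation rho T) (x y : A) (u : V) :
  rho_tilde rho T x (rho_tilde rho T y u) =
  rho (rb_op A x) (rho (rb_op A y) u)
  - T (rho (rb_op A x) (rho y u) + rho x (rho (rb_op A y) u)
       + lambda *: rho x (rho y u)).
Proof.
rewrite [rho_tilde rho T y u]rho_tildeE linearB rho_tilde_intertwine //.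
by rewrite rho_tildeE -addrA -opprD -linearD /= addrCA !addrA.
Qed.

Lemma rho_tilde_representation (K : fieldType) (lambda : K)
    (A : rbjjAlgebra lambda) (V : lmodType K) (rho : A -> {linear V -> V})
    (T : {linear V -> V}) (hV : rbjj_representation rho T) :
  jj_representation (A := rb_jjAlgebra A) (rho_tilde rho T).
Proof.
have [hrho _] := hV; have [rhoL rhoM] := hrho.
split=> [a x y u | x y u].
  by rewrite !rho_tildeE linearP !rhoL linearP /= scalerBr opprD addrACA.
(* The six terms are grouped by the order of [x] and [y], to match the two
   brackets given by [rho_tilde_comp]. *)
have rho_rb_mul :
    rho (rb_mul x y) u =
    - ((rho (rb_op A x) (rho y u) + rho x (rho (rb_op A y) u)
        + lambda *: rho x (rho y u))
       + (rho (rb_op A y) (rho x u) + rho y (rho (rb_op A x) u)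
          + lambda *: rho y (rho x u))).
  rewrite /rb_mul !(jj_representationD hrho) (jj_representationZ hrho) !rhoM.
  rewrite -!opprD scalerN -!opprD scalerDr; congr (- _).
  by rewrite !addrA [LHS](ACl (1*3*5*4*2*6)%AC).
rewrite !rho_tilde_comp // rho_tildeE /= rb_op_rb_mul rhoM rho_rb_mul.
by rewrite linearN linearD opprK !opprB [RHS]addrACA [RHS]addrC.
Qed.

Theorem theorem2p19 (K : fieldType) (char0 : [pchar K] =i pred0) (lambda : K)
    (A : rbjjAlgebra lambda) (V : lmodType K)
    (rho : A -> {linear V -> V}) (T : {linear V -> V})
    (hV : rbjj_representation rho T) :
  jj_representation (A := rb_jjAlgebra A) (rho_tilde rho T) /\
  rbjj_representation (A := rb_derived A) (rho_tilde rho T) T.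
Proof.
have hrep := rho_tilde_representation hV.
split=> //; split=> // x u.
rewrite [LHS](rho_tilde_intertwine hV).
rewrite [rho_tilde rho T x (T u)](rho_tilde_intertwine hV).
congr (T _).
rewrite 2!rho_tildeE [T (_ + _)]linearD [T (_ *: _)]linearZ scalerBr /=.
by rewrite [X in _ = X + _]addrA subrK addrACA subrr addr0.
Qed.
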